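(* Every $CCS$-normal topological space is a $C$-normal space.
   Context: A topological space $X$ is called cellular-compact if for any disjoint (i.e. pairwise disjoint) family $\mathcal{U}$ of non-empty open subsets of $X$ there exists a compact subset $K$ of $X$ such that $K\cap U\neq\emptyset$ for every $U\in\mathcal{U}$. A subset is called cellular-compact if it is cellular-compact in its subspace topology. A space $X$ is called $CCS$-normal (resp. $C$-normal) if there exist a normal space $Y$ and a bijection $f:X\to Y$ such that $f|_C:C\to f(C)$ is a homeomorphism (subspace topologies) for every cellular-compact (resp. compact) subspace $C$ of $X$. The map $f$ itself is not assumed continuous. *)

(* Defs.v *)
From HB Require Import structures.
From mathcomp Require Import all_boot all_order all_classical.
From mathcomp Require Import topology.

Set Implicit Arguments.
Unset Strict Implicit.
Unset Printing Implicit Defensive.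

Local Open Scope classical_set_scope.

(* Below, a subset C : set X used as a type is the subtype [set_type C], which
   carries the subspace topology (the initial topology of the inclusion). *)

(* The family is a set of sets: [trivIset U id] says that two members of U
   that meet are equal. *)
Definition cellular_compact_space (X : topologicalType) : Prop :=
  forall U : set (set X),
    (forall A, U A -> open A /\ A !=set0) ->
    trivIset U id ->
    exists K : set X, compact K /\ forall A, U A -> K `&` A !=set0.

Definition cellular_compact (X : topologicalType) (C : set X) : Prop :=
  cellular_compact_space C.

Definition homeomorphism (S T : topologicalType) (g : S -> T) : Prop :=
  continuous g /\
  exists h : T -> S, [/\ cancel g h, cancel h g & continuous h].

(* The restriction f|_C, with codomain cut down to the image f(C). *)
Definition restr_image (X Y : Type) (f : X -> Y) (C : set X) (x : C) : f @` C :=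
  SigSub (mem_set (imageP f (set_valP x))).

(* As in the library, normality does not include the T1 axiom. *)
Definition CCS_normal (X : topologicalType) : Prop :=
  exists (Y : topologicalType) (f : X -> Y),
    [/\ normal_space Y, bijective f &
        forall C : set X, cellular_compact C ->
          homeomorphism (@restr_image X Y f C)].

Definition C_normal (X : topologicalType) : Prop :=
  exists (Y : topologicalType) (f : X -> Y),
    [/\ normal_space Y, bijective f &
        forall C : set X, compact C ->
          homeomorphism (@restr_image X Y f C)].

(* Main.v *)
Require Import Defs.
From mathcomp Require Import all_boot all_order all_classical.
From mathcomp Require Import topology.

Local Open Scope classical_set_scope.

(** A compact subspace is cellular-compact: the whole subspace serves as the compact set meeting
    every non-empty open set. Hence the [Y] and [f] given by CCS-normality also witness
    C-normality. *)

Lemma compact_set_type (X : topologicalType) (C : set X) :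
  compact C -> compact [set: C].
Proof.
move=> cC F PF _.
have FC : (set_val @ F) C by apply: (@filterS _ F _ setT) => [x _|]; [exact: set_valP|exact: filterT].
(* Compactness in [X] is applied to the pushforward of [F] along the inclusion. *)
have [p [Cp clp]] := cC _ (fmap_proper_filter set_val PF) FC.
(* [p] also clusters [F] in [C]: a neighbourhood [B] of it contains the trace of an open [V] of [X],
   and [V] meets the image of [A]. *)
exists (SigSub (mem_set Cp)); split=> // A B FA [_ [[V oV <-] /= Vp] VB].
have FvA : (set_val @ F) (set_val @` A).
  by apply: (@filterS _ F _ A) => // x Ax; exists x.
have [_ [[a Aa <-] Va]] := clp _ V FvA (open_nbhs_nbhs (conj oV Vp)).
by exists a; split=> //; exact: VB.
Qed.

Lemma compact_cellular_compact (X : topologicalType) (C : set X) :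
  compact C -> cellular_compact C.
Proof.
move=> cC U oU _; exists setT; split; first exact: compact_set_type.
by move=> A /oU[_]; rewrite setTI.
Qed.

Theorem theorem2p2 (X : topologicalType) : CCS_normal X -> C_normal X.
Proof.
move=> [Y [f [nY bf hf]]]; exists Y, f; split=> // C cC.
exact/hf/compact_cellular_compact.
Qed.
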